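(* Let $k\ge1$ be an integer and let $\ell$ be an integer with $\ell=3$ or $\ell\ge6$. Then for every $n\ge0$ the coefficient of $q^n$ in the power series $$(-1)^k\left((q^\ell;q^\ell)_\infty-\frac{(q^\ell;q^\ell)_\infty}{(q;q)_\infty}\sum_{j=-k+1}^{k}(-1)^jq^{j(3j-1)/2}\right)$$ is nonnegative.
   Context: $(a;p)_\infty=\prod_{m\ge0}(1-ap^m)$. *)

(* Defs.v *)
From HB Require Import structures.
From mathcomp Require Import all_boot all_order all_algebra.
From mathcomp Require Import boolp zify.

Set Implicit Arguments.
Unset Strict Implicit.
Unset Printing Implicit Defensive.

Import Order.TTheory GRing.Theory Num.Theory.
Local Open Scope ring_scope.

(* The ring R[[q]] of formal power series, wrapped in a record so that its    *)
(* Cauchy product does not clash with the pointwise structures on nat -> R.   *)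
Record fps (R : Type) := Fps { fpscoef : nat -> R }.

Lemma fpsP (R : Type) (f g : fps R) : fpscoef f =1 fpscoef g <-> f = g.
Proof. by case: f g => [f] [g]; split=> [/= /funext ->|->]. Qed.

HB.instance Definition _ (R : Type) := gen_eqMixin (fps R).
HB.instance Definition _ (R : Type) := gen_choiceMixin (fps R).

Section FpsRing.
Variable R : comUnitRingType.
Implicit Types f g h : fps R.

Definition fps_zero : fps R := Fps (fun _ => 0).
Definition fps_one : fps R := Fps (fun n => (n == 0%N)%:R).
Definition fps_opp f : fps R := Fps (fun n => - fpscoef f n).
Definition fps_add f g : fps R := Fps (fun n => fpscoef f n + fpscoef g n).
Definition fps_mul f g : fps R :=
  Fps (fun n => \sum_(i < n.+1) fpscoef f i * fpscoef g (n - i)).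

Lemma fps_addA : associative fps_add.
Proof. by move=> f g h; apply/fpsP => n /=; rewrite addrA. Qed.

Lemma fps_addC : commutative fps_add.
Proof. by move=> f g; apply/fpsP => n /=; rewrite addrC. Qed.

Lemma fps_add0 : left_id fps_zero fps_add.
Proof. by move=> f; apply/fpsP => n /=; rewrite add0r. Qed.

Lemma fps_addN : left_inverse fps_zero fps_opp fps_add.
Proof. by move=> f; apply/fpsP => n /=; rewrite addNr. Qed.

HB.instance Definition _ :=
  GRing.isZmodule.Build (fps R) fps_addA fps_addC fps_add0 fps_addN.

Definition fps_trunc N f : {poly R} := \poly_(i < N) fpscoef f i.

Lemma coef_fps_trunc N f n : (n < N)%N -> (fps_trunc N f)`_n = fpscoef f n.
Proof. by move=> ltnN; rewrite coef_poly ltnN. Qed.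

Lemma fps_mul_trunc N f g n : (n < N)%N ->
  fpscoef (fps_mul f g) n = (fps_trunc N f * fps_trunc N g)`_n.
Proof.
move=> ltnN; rewrite coefM; apply: eq_bigr => i _.
rewrite !coef_fps_trunc //; first exact: leq_ltn_trans (leq_subr _ _) ltnN.
by apply: leq_ltn_trans ltnN; rewrite -ltnS.
Qed.

Lemma fps_mulC : commutative fps_mul.
Proof.
by move=> f g; apply/fpsP => n; rewrite !(@fps_mul_trunc n.+1) // mulrC.
Qed.

Lemma fps_mulA : associative fps_mul.
Proof.
move=> f g h; apply/fpsP => n.
have aux N a b c m : (m < N)%N -> fpscoef (fps_mul a (fps_mul b c)) m =
    (fps_trunc N a * (fps_trunc N b * fps_trunc N c))`_m.
  move=> ltmN; rewrite coefM; apply: eq_bigr => i _.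
  rewrite coef_fps_trunc ?(@fps_mul_trunc N) //.
    exact: leq_ltn_trans (leq_subr _ _) ltmN.
  by apply: leq_ltn_trans ltmN; rewrite -ltnS.
rewrite [fps_mul (fps_mul f g) h]fps_mulC !(@aux n.+1) //.
by rewrite mulrA [in RHS]mulrC.
Qed.

Lemma fps_mul1 : left_id fps_one fps_mul.
Proof.
move=> f; apply/fpsP => n /=.
by rewrite big_ord_recl big1 ?addr0 ?mul1r ?subn0 // => i _; rewrite mul0r.
Qed.

Lemma fps_mulDl : left_distributive fps_mul fps_add.
Proof.
move=> f g h; apply/fpsP => n /=; rewrite -big_split /=.
by apply: eq_bigr => i _; rewrite mulrDl.
Qed.

Lemma fps_one_neq0 : fps_one != 0.
Proof.
by apply/eqP => /fpsP/(_ 0%N) /= /eqP; rewrite oner_eq0.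
Qed.

HB.instance Definition _ :=
  GRing.Zmodule_isComNzRing.Build (fps R)
    fps_mulA fps_mulC fps_mul1 fps_mulDl fps_one_neq0.

Lemma fpscoef0 n : fpscoef (0 : fps R) n = 0.
Proof. by []. Qed.

Lemma fpscoef1 n : fpscoef (1 : fps R) n = (n == 0%N)%:R.
Proof. by []. Qed.

Lemma fpscoefN f n : fpscoef (- f) n = - fpscoef f n.
Proof. by []. Qed.

Lemma fpscoefD f g n : fpscoef (f + g) n = fpscoef f n + fpscoef g n.
Proof. by []. Qed.

Lemma fpscoefM f g n :
  fpscoef (f * g) n = \sum_(i < n.+1) fpscoef f i * fpscoef g (n - i).
Proof. by []. Qed.

(* The first n+1 coefficients of 1 / f, obtained by solving f * g = 1 degree  *)
(* by degree; the whole list is carried along as each one needs all the       *)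
(* previous ones.                                                             *)
Fixpoint fps_inv_seq f n : seq R :=
  if n is m.+1 then
    let s := fps_inv_seq f m in
    rcons s (- (fpscoef f 0)^-1 * \sum_(i < m.+1) fpscoef f i.+1 * s`_(m - i))
  else [:: (fpscoef f 0)^-1].

Lemma size_fps_inv_seq f n : size (fps_inv_seq f n) = n.+1.
Proof. by elim: n => //= n IHn; rewrite size_rcons IHn. Qed.

Lemma nth_fps_inv_seq f n m : (m <= n)%N ->
  (fps_inv_seq f n)`_m = (fps_inv_seq f m)`_m.
Proof.
elim: n => [|n IHn]; first by rewrite leqn0 => /eqP ->.
rewrite leq_eqVlt => /orP[/eqP -> //|]; rewrite ltnS => lemn.
by rewrite [LHS]/= nth_rcons size_fps_inv_seq ltnS lemn IHn.
Qed.

Definition fps_unit : {pred fps R} :=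
  fun f => fpscoef f 0 \is a GRing.unit.

(* Non-units are sent to themselves, as unitRingType requires. *)
Definition fps_inv f : fps R :=
  if f \in fps_unit then Fps (fun n => (fps_inv_seq f n)`_n) else f.

Lemma fps_mulVr : {in fps_unit, left_inverse 1 fps_inv *%R}.
Proof.
move=> f uf; rewrite mulrC /fps_inv uf.
set g := Fps _; have gS n : fpscoef g n.+1 = - (fpscoef f 0)^-1 *
    \sum_(i < n.+1) fpscoef f i.+1 * (fps_inv_seq f n)`_(n - i).
  by rewrite /= nth_rcons size_fps_inv_seq ltnn eqxx.
apply/fpsP => -[|n]; first by rewrite fpscoefM big_ord1 /= mulrV.
rewrite fpscoefM fpscoef1 big_ord_recl subn0 gS mulNr mulrN mulrA mulrV //.
rewrite mul1r addrC; apply/eqP; rewrite subr_eq0; apply/eqP/eq_bigr => i _.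
by rewrite /= /bump /= add1n subSS [in RHS]nth_fps_inv_seq ?leq_subr.
Qed.

Lemma fps_unitPl f g : g * f = 1 -> f \in fps_unit.
Proof.
move=> /fpsP/(_ 0%N); rewrite fpscoefM big_ord1 /= => gf1.
by apply/unitrPr; exists (fpscoef g 0); rewrite mulrC.
Qed.

Lemma fps_inv_out : {in [predC fps_unit], fps_inv =1 id}.
Proof. by move=> f; rewrite inE /= /fps_inv => /negbTE ->. Qed.

HB.instance Definition _ :=
  GRing.ComNzRing_hasMulInverse.Build (fps R)
    fps_mulVr fps_unitPl fps_inv_out.

Lemma fps_unitE f : (f \is a GRing.unit) = (fpscoef f 0 \is a GRing.unit).
Proof. by []. Qed.

Definition fpsX : fps R := Fps (fun n => (n == 1%N)%:R).

Lemma fpscoefX n i : fpscoef (fpsX ^+ n) i = (i == n)%:R.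
Proof.
elim: n i => [|n IHn] i; first by rewrite expr0.
rewrite exprS fpscoefM; case: i => [|i]; first by rewrite big_ord1 mul0r.
rewrite 2!big_ord_recl big1 => [|j _]; last by rewrite mul0r.
by rewrite mul0r add0r addr0 mul1r /= /bump /= subSS subn0 IHn.
Qed.

(* (a; p)_oo = \prod_(m >= 0) (1 - a * p ^+ m), for p without constant term:  *)
(* by qpochE below, the coefficient of q ^ n is then the same in all partial  *)
(* products with at least n + 1 factors.                                      *)
Definition qpoch (a p : fps R) : fps R :=
  Fps (fun n => fpscoef (\prod_(m < n.+1) (1 - a * p ^+ m)) n).

Lemma fpscoef_expr_lt p n i :
  fpscoef p 0 = 0 -> (i < n)%N -> fpscoef (p ^+ n) i = 0.
Proof.
move=> p0; elim: n i => // n IHn i lein; rewrite exprS fpscoefM.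
apply: big1 => -[[|j] /= ltj] _; first by rewrite p0 mul0r.
by rewrite IHn ?mulr0 // ltn_subLR //; lia.
Qed.

Lemma qpochE (a p : fps R) (n N : nat) : fpscoef p 0 = 0 -> (n < N)%N ->
  fpscoef (\prod_(m < N) (1 - a * p ^+ m)) n = fpscoef (qpoch a p) n.
Proof.
move=> p0; elim: N => // N IHN; rewrite ltnS leq_eqVlt.
case/orP => [/eqP -> //|ltnN]; rewrite -IHN // big_ord_recr.
rewrite [X in fpscoef X n]/= mulrDr mulr1 mulrN fpscoefD fpscoefN.
rewrite [X in _ - X](_ : _ = 0) ?subr0 //.
rewrite mulrA fpscoefM big1 // => i _; rewrite fpscoef_expr_lt ?mulr0 //.
exact: leq_ltn_trans (leq_subr _ _) ltnN.
Qed.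

Lemma qpoch_unit : qpoch fpsX fpsX \is a GRing.unit.
Proof.
rewrite fps_unitE /qpoch /= big_ord1 expr0 mulr1 fpscoefD fpscoefN /=.
by rewrite subr0 unitr1.
Qed.

End FpsRing.

Arguments fpsX {R}.

Notation "''q'" := fpsX (at level 0) : ring_scope.

(* The integers a, a + 1, ..., b; empty when b < a. *)
Definition zrange (a b : int) : seq int :=
  if a <= b then [seq a + i%:Z | i <- iota 0 (absz (b - a + 1))] else [::].

Lemma mem_zrange (a b j : int) : (j \in zrange a b) = (a <= j <= b).
Proof.
rewrite /zrange; case: ifPn => [leab|nleab]; last first.
  rewrite in_nil; apply/esym/negbTE; apply: contraNN nleab => /andP[].
  exact: le_trans.
have ge0 : 0 <= b - a + 1 by rewrite addr_ge0 ?subr_ge0.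
apply/mapP/andP => [[i]|[leaj lejb]].
  rewrite mem_iota /= add0n -ltz_nat gez0_abs // ltzD1 lerBrDl => leib ->.
  by rewrite lerDl.
exists (absz (j - a)); last by lia.
by rewrite mem_iota; lia.
Qed.

Lemma zrange_uniq (a b : int) : uniq (zrange a b).
Proof.
rewrite /zrange; case: ifP => // _; rewrite map_inj_uniq ?iota_uniq //.
by move=> i j /addrI [].
Qed.

(* By pent2 and pent_ge0 the division is exact and the result nonnegative, so  *)
(* that 'q ^ pent j is an ordinary power of 'q.                               *)
Definition pent (j : int) : int := ((j * (3 * j - 1)) %/ 2)%Z.

Lemma pent2 (j : int) : pent j * 2 = j * (3 * j - 1).
Proof.
rewrite /pent divzK //.
by rewrite dvdzE abszM Euclid_dvdM //; case: j => n; lia.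
Qed.

Lemma pent_ge0 (j : int) : 0 <= pent j.
Proof. by rewrite -(pmulr_lge0 _ (isT : 0 < 2 :> int)) pent2; nia. Qed.

(* Main.v *)
Require Import Defs.
From mathcomp Require Import all_boot all_order all_algebra.
From mathcomp Require Import zify ring.

Set Implicit Arguments.
Unset Strict Implicit.
Unset Printing Implicit Defensive.

Import Order.TTheory GRing.Theory Num.Theory.
Local Open Scope ring_scope.

(** Write T_k for the truncated sum, Q for the Euler product in q and L for the
    Euler product in q^l.  By the pentagonal number theorem Q is the limit of
    the T_K, so the series in question is (L / Q) P_k, where

      P_k = (-1)^k (Q - T_k)
          = sum_(j >= k) (-1)^(j-k) q^(e_j) (1 - q^(2j+1)),  e_j = j(3j+1)/2.

    Now L / Q is the product of the 1 / (1 - q^i) over the i that l does not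
    divide, and for l = 3 or l >= 6 these include i = 1, 2, 5.  So L / Q is
    G / ((1-q)(1-q^2)(1-q^5)) with G nonnegative ([regular_quotient]).

    For k >= 2 the three factors alone make P_k nonnegative, as one sees by
    regrouping P_k ([pent_sum_block]).  The difference of the terms j and j+1
    has negative coefficients even after the division; adding and subtracting
    q^(e_j) (1 - q^(j-2)) between consecutive pairs turns P_k into
    q^(e_k) (1 - q^(k-2)) plus the sum over j = k, k+2, ... of a power of q times

      (1-q^(j+3)) (1-q^(2(j+2))) - q^(3j+7) (1-q^j) (1-q^(2(j+1))).

    Divided by (1-q)(1-q^2), the two products count the pairs (a,b) of a box,
    by the value of a + 2b; the boxes have (j+3)(j+2) and j(j+1) points, and
    all values in the first are smaller than 3j+7.  Dividing by 1-q^5 adds up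
    coefficients along residue classes modulo 5.  Each class receives a fifth
    of the points of a box up to an error of 4/5 ([class_count_bounds]), so the
    surplus 4j+6 of the first box makes the difference nonnegative
    ([box_dominates]).

    For k = 1 the series is (1-q) L / Q - L.  The first term is at least
    1 / ((1-q^2)(1-q^5)), whose coefficients are positive except at q and q^3,
    while L, the pentagonal series in q^l, has coefficients at most 1, and no
    positive one at q or q^3 as l >= 3. *)

(** * Generalized pentagonal numbers and Shanks' identity *)

Definition gpent (j : nat) : nat := (j * j + 'C(j.+1, 2))%N.

Lemma gpentS j : gpent j.+1 = (gpent j + 3 * j + 2)%N.
Proof. rewrite /gpent binS bin1; lia. Qed.

Lemma double_gpent j : (2 * gpent j = j * (3 * j + 1))%N.
Proof. elim: j => // j IHj; rewrite gpentS; lia. Qed.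

Section Pentagonal.
Variables (R : comNzRingType) (x : R).

Definition pent_sum n : R :=
  \sum_(j < n) (-1) ^+ j * x ^+ gpent j * (1 - x ^+ (2 * j + 1)).

(** For m = n this is the right-hand side of Shanks' finite form of the
    pentagonal number theorem.  The product stands for (x;x)_n / (x;x)_s, and
    the separate upper bound m is there for the induction. *)
Definition shanks_sum n m : R :=
  \sum_(s < m)
    (-1) ^+ s * (\prod_(s <= i < n) (1 - x ^+ i.+1)) * x ^+ (s * n + 'C(s.+1, 2)).

(** Passing from n to n + 1 changes the summands by differences of consecutive
    values of one expression; the correction on the left is what telescoping
    leaves. *)
Lemma shanks_sum_step n m : (m <= n)%N ->
  shanks_sum n.+1 m.+1 + (-1) ^+ m * (\prod_(m <= i < n) (1 - x ^+ i.+1))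
    * x ^+ (m.+1 * n.+1 + 'C(m.+1, 2)) = shanks_sum n m.+1.
Proof.
elim: m => [|m IHm] lemn.
  rewrite /shanks_sum !big_ord_recr !big_ord0 /= big_nat_recr //=.
  rewrite !add0r !mul0n !expr0 !mul1n !bin_small // !addn0 ?expr0; ring.
rewrite /shanks_sum big_ord_recr [RHS]big_ord_recr /= -/(shanks_sum _ _).
rewrite -/(shanks_sum n m.+1) -IHm 1?ltnW //.
rewrite -!addrA; congr (_ + _).
rewrite (big_nat_recr n) //= [in RHS](big_ltn lemn).
rewrite [in 'C(m.+2, 2)]binS bin1 ![(-1) ^+ m.+1]exprS.
move: (\prod_(m.+1 <= i < n) _) => P.
have -> : (m.+1 * n.+1 + ('C(m.+1, 2) + m.+1) =
  (m * n + m + n + 'C(m.+1, 2)) + m.+2)%N by lia.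
have -> : (m.+2 * n.+1 + ('C(m.+1, 2) + m.+1) =
  (m * n + m + n + 'C(m.+1, 2)) + m.+2 + n.+1)%N by lia.
have -> : (m.+1 * n + ('C(m.+1, 2) + m.+1) =
  (m * n + m + n + 'C(m.+1, 2)) + 1)%N by lia.
have -> : (m.+1 * n.+1 + 'C(m.+1, 2) =
  (m * n + m + n + 'C(m.+1, 2)) + 1)%N by lia.
rewrite !exprD -[m.+2]addn2 -[n.+1]addn1 -[m.+1]addn1 !exprD; ring.
Qed.

Lemma shanks_sumE n : shanks_sum n n = pent_sum n.
Proof.
elim: n => [|n IHn]; first by rewrite /shanks_sum /pent_sum !big_ord0.
rewrite /pent_sum big_ord_recr /= -/(pent_sum n) -IHn.
have := shanks_sum_step (leqnn n).
rewrite [shanks_sum n n.+1]big_ord_recr /= -/(shanks_sum n n) big_geq // !mulr1.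
move=> /(canRL (addrK _)) ->; rewrite -/(gpent n).
have -> : (n.+1 * n.+1 + 'C(n.+1, 2) = gpent n + (2 * n + 1))%N.
  by rewrite /gpent; lia.
by rewrite exprD mulrBr mulr1 addrA mulrA.
Qed.

(** In Shanks' sum only s = 0 contributes below x^n, and it is (x;x)_n: this is
    how the pentagonal number theorem is used. *)
Lemma pent_sum_prod n :
  exists h, pent_sum n = \prod_(i < n) (1 - x ^+ i.+1) + x ^+ n * h.
Proof.
case: n => [|n].
  by exists (-1); rewrite /pent_sum !big_ord0 expr0 mul1r subrr.
exists (\sum_(i < n) (-1) ^+ i.+1 * (\prod_(i.+1 <= j < n.+1) (1 - x ^+ j.+1))
   * x ^+ (i * n.+1 + 'C(i.+2, 2))).
rewrite -shanks_sumE /shanks_sum [LHS]big_ord_recl /= big_mkord.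
rewrite bin_small // mul0n addn0 !expr0 mul1r mulr1.
rewrite mulr_sumr; congr (_ + _); apply: eq_bigr => i _.
rewrite /bump /= add1n mulSn -addnA [x ^+ (n.+1 + _)]exprD; ring.
Qed.

(** * Regrouping the pentagonal series *)

(** The regrouped pair of the terms j + 2 and j + 3: the shift by 2 keeps all
    exponents free of subtraction. *)
Definition pent_block j : R :=
  x ^+ (gpent j.+2 + j) * ((1 - x ^+ (j + 5)) * (1 - x ^+ (2 * (j + 4)))
    - x ^+ (3 * j + 13) * ((1 - x ^+ (j + 2)) * (1 - x ^+ (2 * (j + 3))))).

(** The outer terms on the right telescope from one pair to the next.  They
    cannot be avoided: the left-hand side, as a polynomial in x, vanishes at
    x = 1 with a positive derivative, hence is negative just below 1, and no
    factors 1 / (1 - x^i) make its coefficients nonnegative. *)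
Lemma pent_blockE j :
  x ^+ gpent j.+2 * (1 - x ^+ (2 * j.+2 + 1))
    - x ^+ gpent j.+3 * (1 - x ^+ (2 * j.+3 + 1)) =
  x ^+ gpent j.+2 * (1 - x ^+ j) + pent_block j
    - x ^+ gpent j.+4 * (1 - x ^+ j.+2).
Proof.
rewrite /pent_block !(gpentS j.+2, gpentS j.+3).
move: (gpent j.+2) => e.
have -> : (2 * j.+2 + 1 = j + j + 5)%N by lia.
have -> : (2 * j.+3 + 1 = j + j + 7)%N by lia.
have -> : (e + 3 * j.+2 + 2 + 3 * j.+3 + 2 = e + j + j + j + j + j + j + 19)%N.
  by lia.
have -> : (e + 3 * j.+2 + 2 = e + j + j + j + 8)%N by lia.
have -> : (2 * (j + 4) = j + j + 8)%N by lia.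
have -> : (2 * (j + 3) = j + j + 6)%N by lia.
have -> : (3 * j + 13 = j + j + j + 13)%N by lia.
rewrite -[j.+2]addn2 !exprD; ring.
Qed.

Lemma pent_sum_block k M :
  (-1) ^+ k * (pent_sum (k.+2 + 2 * M) - pent_sum k.+2) =
    x ^+ gpent k.+2 * (1 - x ^+ k) + \sum_(m < M) pent_block (k + 2 * m)
    - x ^+ gpent (k + 2 * M).+2 * (1 - x ^+ (k + 2 * M)).
Proof.
elim: M => [|M IHM]; first by rewrite muln0 !addn0 big_ord0; ring.
rewrite big_ord_recr /=.
have -> : (k.+2 + 2 * M.+1 = (k + 2 * M).+4)%N by lia.
have -> : (k + 2 * M.+1 = (k + 2 * M).+2)%N by lia.
have sgn : (-1) ^+ k * (-1) ^+ (k + 2 * M) = 1 :> R.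
  by rewrite -exprD -signr_odd (_ : odd _ = false) //; lia.
rewrite !addSn in IHM; move: IHM sgn; set j := (k + 2 * M)%N => IHM sgn.
have step := pent_blockE j.
rewrite [pent_sum _.+4]big_ord_recr big_ord_recr /= -/(pent_sum j.+2).
have sgn2 : (-1) ^+ j.+2 = (-1) ^+ j :> R by rewrite !exprS; ring.
rewrite [(-1) ^+ j.+3]exprS sgn2.
transitivity ((-1) ^+ k * (pent_sum j.+2 - pent_sum k.+2)
  + (-1) ^+ k * (-1) ^+ j * (x ^+ gpent j.+2 * (1 - x ^+ (2 * j.+2 + 1))
    - x ^+ gpent j.+3 * (1 - x ^+ (2 * j.+3 + 1)))); first by ring.
by rewrite sgn mul1r IHM step; ring.
Qed.

End Pentagonal.

(** * Power series modulo a power of the variable *)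

Section Series.
Variable R : comUnitRingType.
Implicit Types f g h : fps R.

Lemma fpscoef_sum (I : Type) (r : seq I) (P : pred I) (F : I -> fps R) n :
  fpscoef (\sum_(i <- r | P i) F i) n = \sum_(i <- r | P i) fpscoef (F i) n.
Proof. exact: (big_morph (fun f => fpscoef f n)). Qed.

Lemma fpscoefXM s f n :
  fpscoef ('q ^+ s * f) n = if (s <= n)%N then fpscoef f (n - s) else 0.
Proof.
rewrite fpscoefM -ltnS -(big_ord1_eq +%R (fun i => fpscoef f (n - i))).
rewrite [RHS]big_mkcond; apply: eq_bigr => i _; rewrite fpscoefX.
by case: eqP => _; rewrite ?mul1r ?mul0r.
Qed.

Lemma unit_1subX m : (0 < m)%N -> (1 - 'q ^+ m : fps R) \is a GRing.unit.
Proof.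
by case: m => // m _; rewrite fps_unitE fpscoefD fpscoefN fpscoefX subr0 unitr1.
Qed.

Lemma fpscoef_geom m n : (0 < m)%N ->
  fpscoef (1 - 'q ^+ m : fps R)^-1 n = (m %| n)%:R.
Proof.
move=> m_gt0; suff -> : (1 - 'q ^+ m)^-1 = Fps (fun n => (m %| n)%:R) :> fps R.
  by [].
apply: (mulrI (unit_1subX m_gt0)); rewrite mulrV ?unit_1subX //.
apply/fpsP => i; rewrite mulrBl mul1r fpscoefD fpscoefN fpscoefXM fpscoef1 /=.
case: leqP => [lemi|ltim].
  by rewrite dvdn_subl // subrr; case: i lemi => //; lia.
rewrite subr0; case: i ltim => [|i] ltim; first by rewrite dvdn0.
by rewrite gtnNdvd.
Qed.

Definition fps_eqmod N f g := forall i, (i < N)%N -> fpscoef f i = fpscoef g i.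

Lemma fps_eqmod_trans N g f h :
  fps_eqmod N f g -> fps_eqmod N g h -> fps_eqmod N f h.
Proof. by move=> fg gh i ltiN; rewrite fg ?gh. Qed.

Lemma fps_eqmodD N f f' g g' :
  fps_eqmod N f f' -> fps_eqmod N g g' -> fps_eqmod N (f + g) (f' + g').
Proof. by move=> ff' gg' i ltiN; rewrite !fpscoefD ff' ?gg'. Qed.

Lemma fps_eqmodM N f f' g g' :
  fps_eqmod N f f' -> fps_eqmod N g g' -> fps_eqmod N (f * g) (f' * g').
Proof.
move=> ff' gg' i ltiN; rewrite !fpscoefM; apply: eq_bigr => j _.
rewrite ff' ?gg' //; first exact: leq_ltn_trans (leq_subr _ _) ltiN.
exact: leq_trans (ltn_ord j) ltiN.
Qed.

Lemma fps_eqmodV N f g : f \is a GRing.unit -> g \is a GRing.unit ->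
  fps_eqmod N f g -> fps_eqmod N f^-1 g^-1.
Proof.
move=> uf ug fg; have -> : f^-1 = f^-1 * g^-1 * g by rewrite mulrVK.
have {2}-> : g^-1 = f^-1 * g^-1 * f by rewrite mulrAC mulVr ?mul1r.
by apply: fps_eqmodM => // i /fg.
Qed.

Lemma fps_eqmod_addXM N s f h : (N <= s)%N -> fps_eqmod N (f + 'q ^+ s * h) f.
Proof.
by move=> leNs i ltiN; rewrite fpscoefD fpscoefXM leqNgt (leq_trans ltiN) // addr0.
Qed.

Lemma unit_prod_1subX (r : seq nat) (P : pred nat) :
  (\prod_(i <- r | P i) (1 - 'q ^+ i.+1) : fps R) \is a GRing.unit.
Proof. by rewrite rpred_prod // => i _; rewrite unit_1subX. Qed.

Lemma qpochXE l N : (0 < l)%N ->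
  fps_eqmod N (qpoch ('q ^+ l) ('q ^+ l))
    (\prod_(0 <= m < N) (1 - ('q ^+ l : fps R) ^+ m.+1)).
Proof.
move=> l_gt0 i ltiN; rewrite -(qpochE _ _ ltiN); last first.
  by rewrite fpscoefX; case: l l_gt0.
by rewrite big_mkord; congr fpscoef; apply: eq_bigr => m _; rewrite exprS.
Qed.

Lemma qpoch_pent_sum l N K : (0 < l)%N -> (N <= K)%N ->
  fps_eqmod N (qpoch ('q ^+ l) ('q ^+ l)) (pent_sum ('q ^+ l : fps R) K).
Proof.
move=> l_gt0 leNK; have [h ->] := pent_sum_prod ('q ^+ l : fps R) K.
rewrite -exprM -(big_mkord xpredT (fun i => 1 - ('q ^+ l : fps R) ^+ i.+1)).
apply: fps_eqmod_trans (_ : fps_eqmod N _ _) _; last first.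
  by move=> i /(fps_eqmod_addXM _ _ _) ->; last by nia.
by move=> i ltiN; rewrite (@qpochXE l K) // (leq_trans ltiN).
Qed.

End Series.

(** * Nonnegative power series *)

Section Nonneg.
Implicit Types f g : fps int.

Definition fps_nneg f := forall n, 0 <= fpscoef f n.

Lemma fps_nneg1 : fps_nneg 1.
Proof. by move=> n; rewrite fpscoef1. Qed.

Lemma fps_nnegX m : fps_nneg ('q ^+ m).
Proof. by move=> n; rewrite fpscoefX. Qed.

Lemma fps_nnegD f g : fps_nneg f -> fps_nneg g -> fps_nneg (f + g).
Proof. by move=> f0 g0 n; rewrite fpscoefD addr_ge0. Qed.

Lemma fps_nnegM f g : fps_nneg f -> fps_nneg g -> fps_nneg (f * g).
Proof.
by move=> f0 g0 n; rewrite fpscoefM; apply: sumr_ge0 => i _; rewrite mulr_ge0.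
Qed.

Lemma fps_nneg_sum (I : Type) (r : seq I) (P : pred I) F :
  (forall i, P i -> fps_nneg (F i)) -> fps_nneg (\sum_(i <- r | P i) F i).
Proof. by move=> F0 n; rewrite fpscoef_sum; apply: sumr_ge0 => i /F0. Qed.

Lemma fps_nneg_geom m : (0 < m)%N -> fps_nneg (1 - 'q ^+ m)^-1.
Proof. by move=> m_gt0 n; rewrite fpscoef_geom. Qed.

Lemma fps_nneg_prodV (r : seq nat) (P : pred nat) :
  fps_nneg (\prod_(i <- r | P i) (1 - 'q ^+ i.+1))^-1 /\
  fpscoef (\prod_(i <- r | P i) (1 - 'q ^+ i.+1) : fps int)^-1 0 = 1.
Proof.
elim: r => [|i r [IHr IHr0]].
  by rewrite big_nil invr1; split; first exact: fps_nneg1.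
rewrite big_cons; case: ifP => // _; rewrite invrM ?unit_1subX ?unit_prod_1subX //.
split; first by apply: fps_nnegM => //; apply: fps_nneg_geom.
by rewrite fpscoefM big_ord1 IHr0 fpscoef_geom.
Qed.

Lemma fpscoefM_ge f g n i : fps_nneg f -> fps_nneg g -> (i <= n)%N ->
  fpscoef f i * fpscoef g (n - i) <= fpscoef (f * g) n.
Proof.
move=> f0 g0 lein; rewrite fpscoefM (bigD1 (Ordinal (lein : i < n.+1)%N)) //=.
by rewrite lerDl sumr_ge0 // => j _; rewrite mulr_ge0.
Qed.

End Nonneg.

(** * Cancellation and products *)

Lemma prodD1_seq (S : comNzRingType) (I : eqType) (r : seq I) (P : pred I)
    (F : I -> S) j : uniq r -> j \in r -> P j ->
  \prod_(i <- r | P i) F i = F j * \prod_(i <- r | P i && (i != j)) F i.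
Proof.
move=> r_uniq rj Pj; rewrite -big_filter (bigD1_seq j) ?filter_uniq //=.
  by rewrite big_filter_cond.
by rewrite mem_filter Pj.
Qed.

Lemma invr_mul_cancel (S : comUnitRingType) (a b c : S) :
  a \is a GRing.unit -> b \is a GRing.unit -> c \is a GRing.unit ->
  b^-1 / c = a * (a * (b * c))^-1.
Proof.
move=> ua ub uc.
by rewrite invrM ?unitrM ?ub // mulrCA mulrV // mulr1 invrM // mulrC.
Qed.

Lemma divr_common_factor (S : comUnitRingType) (d c e s a b : S) :
  d \is a GRing.unit -> c \is a GRing.unit ->
  e * (d * a - s * (d * b)) / (d * c) = e * ((a - s * b) / c).
Proof.
move=> ud uc; have -> : e * (d * a - s * (d * b)) = e * (a - s * b) * d by ring.
by rewrite invrM // [c^-1 * _]mulrC -!mulrA mulVKr.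
Qed.

Lemma divr_first_factor (S : comUnitRingType) (d b c e : S) :
  d \is a GRing.unit -> b \is a GRing.unit -> c \is a GRing.unit ->
  d * e / (d * b * c) = e / b / c.
Proof.
move=> ud ub uc; have -> : (d * b * c)^-1 = d^-1 * (b^-1 * c^-1).
  by rewrite invrM ?unitrM ?ud // invrM // mulrC [b^-1 * _]mulrC -mulrA.
by rewrite -!mulrA [e * _]mulrCA mulVKr.
Qed.

(** * The quotient of the two Euler products *)

Lemma prod_multiples (S : comNzRingType) (x : S) l N : (0 < l)%N ->
  \prod_(0 <= i < N * l) (1 - x ^+ i.+1) =
  \prod_(0 <= m < N) (1 - (x ^+ l) ^+ m.+1) *
  \prod_(0 <= i < N * l | ~~ (l %| i.+1)%N) (1 - x ^+ i.+1).
Proof.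
case: l => // l _; rewrite (bigID (fun i => l.+1 %| i.+1)%N) /=; congr (_ * _).
elim: N => [|N IHN]; first by rewrite mul0n !big_geq.
rewrite [RHS]big_nat_recr //= -IHN (big_cat_nat (n := (N * l.+1)%N)) //=;
  last by rewrite leq_mul2r leqnSn orbT.
congr (_ * _); rewrite mulSnr addnS big_mkcond big_nat_recr ?leq_addr //=.
rewrite -addnS -mulSnr dvdn_mull // big_nat_cond big1 ?mul1r -?exprM 1?mulnC //.
move=> i /andP[/andP[le1 lt2] _]; case: ifP => // /dvdnP[c ec]; exfalso.
have ltNc : (N < c)%N by nia.
by nia.
Qed.

Definition denom125 : fps int := (1 - 'q) * (1 - 'q ^+ 2) * (1 - 'q ^+ 5).

(** Under the hypothesis l divides none of 1, 2, 5, so these three factors of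
    the denominator survive the cancellation and the others are collected in g.
    Only finitely many factors matter below q^N, hence the congruence.  The
    constant term of g gives a lower bound on products with g. *)
Lemma regular_quotient l N : l = 3%N \/ (6 <= l)%N ->
  exists2 g, fps_nneg g /\ fpscoef g 0 = 1 &
    fps_eqmod N (qpoch ('q ^+ l) ('q ^+ l) / qpoch 'q 'q) (g / denom125).
Proof.
move=> hl; have l_ge3 : (3 <= l)%N by case: hl => [->|]; lia.
(* Enough factors to reach degree N and to include the exponent 5. *)
pose M := N.+2; have M5 : (5 < M * l)%N by rewrite /M; nia.
have l1 : ~~ (l %| 1)%N by rewrite gtnNdvd //; lia.
have l2 : ~~ (l %| 2)%N by rewrite gtnNdvd.
have l5 : ~~ (l %| 5)%N by case: hl => [-> //|?]; rewrite gtnNdvd.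
pose D : fps int := \prod_(i <- index_iota 0 (M * l) |
  [&& ~~ (l %| i.+1)%N, i != 0%N, i != 1%N & i != 4%N]) (1 - 'q ^+ i.+1).
exists D^-1; first exact: fps_nneg_prodV.
have uE : denom125 \is a GRing.unit.
  by rewrite /denom125 !unitrM -{1}['q]expr1 !unit_1subX.
have uD : D \is a GRing.unit by rewrite unit_prod_1subX.
pose L : fps int := \prod_(0 <= m < M) (1 - ('q ^+ l) ^+ m.+1).
have defQ : \prod_(0 <= i < M * l) (1 - ('q : fps int) ^+ i.+1) =
    L * (D * denom125).
  rewrite (prod_multiples _ _ (ltn_trans _ l_ge3)) //; congr (_ * _).
  rewrite /D (@prodD1_seq _ _ _ _ _ 0%N) ?iota_uniq ?mem_index_iota //=; try lia.
  rewrite (@prodD1_seq _ _ _ _ _ 1%N) ?iota_uniq ?mem_index_iota ?l2 //=; try lia.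
  rewrite (@prodD1_seq _ _ _ _ _ 4%N) ?iota_uniq ?mem_index_iota ?l5 //=; try lia.
  under eq_bigl => i do rewrite -!andbA.
  by rewrite /denom125 expr1; ring.
have uL : L \is a GRing.unit.
  rewrite /L rpred_prod // => i _.
  by rewrite -exprM unit_1subX // muln_gt0; case: (l) l_ge3.
rewrite (invr_mul_cancel uL uD uE); apply: fps_eqmodM.
  by move=> i ltiN; rewrite (@qpochXE _ l M) //; rewrite /M; lia.
have uLDE : L * (D * denom125) \is a GRing.unit by rewrite -defQ unit_prod_1subX.
apply: fps_eqmodV => //; first exact: qpoch_unit.
move=> i ltiN; rewrite -defQ -{1 2}['q]expr1 (@qpochXE _ 1 (M * l)) ?expr1 //.
by rewrite /M; nia.
Qed.

(** * Residue classes modulo 5 in a box *)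

Definition class_count X Y r : nat :=
  \sum_(0 <= a < X) \sum_(0 <= b < Y) (a + 2 * b == r %[mod 5]).

Lemma class_count_addl X Y r :
  class_count X.+4.+1 Y r = (class_count X Y r + Y)%N.
Proof.
rewrite /class_count !(@big_nat_recr _ _ _ _ _ (fun a => \sum_(0 <= b < Y) _)) //=.
rewrite -!addnA; congr addn; rewrite -!big_split /=.
rewrite -[RHS]muln1 -[in RHS](subn0 Y) -sum_nat_const_nat.
by apply: eq_bigr => b _; lia.
Qed.

Lemma class_count_addr X Y r :
  class_count X Y.+4.+1 r = (class_count X Y r + X)%N.
Proof.
transitivity (class_count X Y r + \sum_(0 <= a < X) 1)%N; last first.
  by rewrite sum_nat_const_nat subn0 muln1.
rewrite /class_count -big_split; apply: eq_bigr => a _ /=.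
by rewrite !big_nat_recr //= -!addnA; congr addn; lia.
Qed.

(** Five consecutive values of a, and likewise of b since 2 is invertible modulo
    5, meet every class exactly once; so five times the count minus X * Y is
    periodic of period 5 in X and in Y, and finitely many cases remain. *)
Lemma class_count_bounds X Y r :
  (X * Y <= 5 * class_count X Y r + 4)%N && (5 * class_count X Y r <= X * Y + 4)%N.
Proof.
have -> : class_count X Y r = class_count X Y (r %% 5).
  by apply: eq_bigr => a _; apply: eq_bigr => b _; rewrite modn_mod.
have : (r %% 5 < 5)%N by rewrite ltn_mod.
move: (r %% 5)%N => {}r ltr5.
have redX n x y : class_count (n * 5 + x) y r = (class_count x y r + n * y)%N.
  elim: n => [|n IHn]; first by rewrite addn0.
  by rewrite mulSn -addnA -[(5 + _)%N]/(n * 5 + x).+4.+1 class_count_addl IHn; lia.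
have redY n x y : class_count x (n * 5 + y) r = (class_count x y r + n * x)%N.
  elim: n => [|n IHn]; first by rewrite addn0.
  by rewrite mulSn -addnA -[(5 + _)%N]/(n * 5 + y).+4.+1 class_count_addr IHn; lia.
have base : all (fun x => all (fun y => all (fun r =>
    (x * y <= 5 * class_count x y r + 4)%N
    && (5 * class_count x y r <= x * y + 4)%N) (iota 0 5)) (iota 0 5)) (iota 0 5).
  by rewrite /class_count unlock; vm_compute.
move: (divn_eq X 5) (ltn_mod X 5); move: (X %/ 5)%N (X %% 5)%N => u x -> ltx5.
move: (divn_eq Y 5) (ltn_mod Y 5); move: (Y %/ 5)%N (Y %% 5)%N => v y -> lty5.
have {base} := allP (allP (allP base x _) y _) r _.
rewrite !mem_iota !add0n ltr5 ltx5 lty5 => /(_ isT isT isT).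
by rewrite redX redY; move: (class_count _ _ _) => c; nia.
Qed.

(** [box X Y] is (1 - q^X)(1 - q^(2Y)) / ((1 - q)(1 - q^2)), the generating
    function of a + 2b over the pairs a < X, b < Y. *)
Definition box X Y : fps int :=
  (\sum_(0 <= a < X) 'q ^+ a) * (\sum_(0 <= b < Y) 'q ^+ (2 * b)).

Lemma fpscoef_box_geom X Y n :
  fpscoef (box X Y / (1 - 'q ^+ 5)) n =
  (\sum_(0 <= a < X) \sum_(0 <= b < Y)
     ((a + 2 * b <= n) && (5 %| n - (a + 2 * b)))%N)%N%:R.
Proof.
rewrite /box mulr_suml mulr_suml fpscoef_sum natr_sum; apply: eq_bigr => a _.
rewrite mulr_sumr mulr_suml fpscoef_sum natr_sum; apply: eq_bigr => b _.
rewrite -exprD fpscoefXM fpscoef_geom //.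
by case: leqP.
Qed.

Lemma fpscoef_box_geom_le X Y n :
  fpscoef (box X Y / (1 - 'q ^+ 5)) n <= (class_count X Y n)%:R.
Proof.
rewrite fpscoef_box_geom ler_nat; apply: leq_sum => a _; apply: leq_sum => b _.
lia.
Qed.

Lemma fpscoef_box_geom_ge X Y n : (X + 2 * Y <= n.+2)%N ->
  fpscoef (box X Y / (1 - 'q ^+ 5)) n = (class_count X Y n)%:R.
Proof.
move=> leXYn; rewrite fpscoef_box_geom /class_count; congr (_%:R).
apply: eq_big_nat => a /andP[_ lta]; apply: eq_big_nat => b /andP[_ ltb].
lia.
Qed.

(** From the exponent X + 2Y on, a coefficient of [box X Y / (1 - q^5)] is the
    full count of a class, at least (X * Y - 4) / 5; a coefficient of the
    subtracted series is at most (Z * W + 4) / 5.  The hypothesis makes their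
    difference greater than -1, hence nonnegative as an integer. *)
Lemma box_dominates X Y Z W : (Z * W + 4 <= X * Y)%N ->
  fps_nneg ((box X Y - 'q ^+ (X + 2 * Y) * box Z W) / (1 - 'q ^+ 5)).
Proof.
move=> leZWXY n; rewrite mulrBl -['q ^+ _ * _ / _]mulrA fpscoefD fpscoefN fpscoefXM.
case: leqP => [lesn|_]; last by rewrite subr0 fpscoef_box_geom.
rewrite subr_ge0 (le_trans (fpscoef_box_geom_le _ _ _)) //.
rewrite fpscoef_box_geom_ge; last by lia.
rewrite ler_nat; have /andP[lo _] := class_count_bounds X Y n.
have /andP[_ hi] := class_count_bounds Z W (n - (X + 2 * Y)).
by lia.
Qed.

(** * Truncations with at least four terms *)

Lemma pent_block_nneg j :
  fps_nneg (pent_block 'q j / denom125).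
Proof.
have boxE X Y : (1 - 'q ^+ X) * (1 - 'q ^+ (2 * Y)) =
    (1 - 'q) * (1 - 'q ^+ 2) * box X Y.
  rewrite exprM -![1 - _ ^+ _]opprB !subrX1 /box !big_mkord.
  rewrite (eq_bigr (fun i : 'I_Y => 'q ^+ (2 * i))); last first.
    by move=> i _; rewrite exprM.
  by ring.
have -> : pent_block 'q j / denom125 =
    'q ^+ (gpent j.+2 + j) * ((box (j + 5) (j + 4)
      - 'q ^+ (j + 5 + 2 * (j + 4)) * box (j + 2) (j + 3)) / (1 - 'q ^+ 5)).
  rewrite /pent_block !boxE; have -> : (j + 5 + 2 * (j + 4) = 3 * j + 13)%N by lia.
  apply: divr_common_factor; last exact: unit_1subX.
  by rewrite unitrM -{1}['q]expr1 !unit_1subX.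
apply: fps_nnegM; first exact: fps_nnegX.
by apply: box_dominates; nia.
Qed.

Lemma truncated_pent_nneg_ge2 k l n : l = 3%N \/ (6 <= l)%N ->
  0 <= fpscoef
    ((-1) ^+ k.+2 *
       (qpoch ('q ^+ l) ('q ^+ l)
        - qpoch ('q ^+ l) ('q ^+ l) / qpoch 'q 'q * pent_sum 'q k.+2)
     : fps int) n.
Proof.
(* N blocks suffice, as the remainder then starts beyond degree N. *)
move=> hl; pose N := n.+1; pose M := N.
have [g [g0 _] quot] := regular_quotient N hl.
pose tail : fps int := 'q ^+ gpent k.+2 * (1 - 'q ^+ k)
  + \sum_(m < M) pent_block 'q (k + 2 * m).
have tail0 : fps_nneg (tail / denom125).
  rewrite /tail mulrDl mulr_suml; apply: fps_nnegD; last first.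
    by apply: fps_nneg_sum => m _; apply: pent_block_nneg.
  have -> : 'q ^+ gpent k.+2 * (1 - 'q ^+ k) =
      (1 - 'q) * ((\sum_(i < k) 'q ^+ i) * 'q ^+ gpent k.+2) :> fps int.
    by rewrite mulrC [RHS]mulrA -[1 - 'q ^+ k]opprB subrX1 -mulNr opprB.
  rewrite divr_first_factor ?unit_1subX //.
  apply: fps_nnegM; last exact: fps_nneg_geom.
  apply: fps_nnegM; last exact: fps_nneg_geom.
  by apply: fps_nnegM; [apply: fps_nneg_sum => i _|]; apply: fps_nnegX.
have tailE : fps_eqmod N ((-1) ^+ k * (qpoch 'q 'q - pent_sum 'q k.+2)) tail.
  apply: (@fps_eqmod_trans _ _
    ((-1) ^+ k * (pent_sum 'q (k.+2 + 2 * M) - pent_sum 'q k.+2))).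
    apply: fps_eqmodM => //; apply: fps_eqmodD => //.
    by have := @qpoch_pent_sum int 1 N (k.+2 + 2 * M) isT; rewrite expr1; apply; lia.
  rewrite pent_sum_block -/tail -mulrN; apply: fps_eqmod_addXM.
  by rewrite /gpent; nia.
have Qu := @qpoch_unit int.
move: quot tailE; set L := qpoch ('q ^+ l) _; set Q := qpoch 'q 'q => quot tailE.
have -> : (-1) ^+ k.+2 * (L - L / Q * pent_sum 'q k.+2) =
    L / Q * ((-1) ^+ k * (Q - pent_sum 'q k.+2)).
  have -> : (-1) ^+ k.+2 = (-1) ^+ k :> fps int by rewrite !exprS; ring.
  by rewrite -{1}[L](divrK Qu) -mulrBr mulrCA.
rewrite (fps_eqmodM quot tailE) // -mulrA [denom125^-1 * _]mulrC.
exact: fps_nnegM.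
Qed.

(** * The two-term truncation *)

(** The exponents of the terms with coefficient +1 in the pentagonal series. *)
Definition gpent_pos j := (gpent j + odd j * (2 * j + 1))%N.

Lemma gpent_pos_inj : injective gpent_pos.
Proof.
have lt i j : (i < j)%N -> (gpent_pos i < gpent_pos j)%N.
  rewrite /gpent_pos => ltij; have := double_gpent i; have := double_gpent j.
  by case: (odd i); case: (odd j); nia.
by move=> i j; case: (ltngtP i j) => // /lt; lia.
Qed.

Lemma fpscoef_pent_sum_le l K n :
  fpscoef (pent_sum ('q ^+ l) K : fps int) n
    <= (\sum_(j < K) (n == l * gpent_pos j))%N%:R.
Proof.
rewrite /pent_sum fpscoef_sum natr_sum; apply: ler_sum => j _.
rewrite -signr_odd /gpent_pos mulrBr mulr1 -mulrA -exprD -!exprM.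
case: (odd j); rewrite ?expr1 ?expr0 ?mulN1r ?mul1r ?mul1n ?mul0n ?addn0.
  rewrite fpscoefD !fpscoefN !fpscoefX; lia.
rewrite fpscoefD !fpscoefN !fpscoefX; lia.
Qed.

(** As the positive exponents are 0 and then at least 5, their multiples by l
    avoid 1 and 3. *)
Lemma gpent_pos_sparse l K n : (3 <= l)%N ->
  (\sum_(j < K) (n == l * gpent_pos j) <= ((n != 1) && (n != 3)))%N.
Proof.
move=> l_ge3.
case: (pickP (fun j : 'I_K => n == l * gpent_pos j)%N) => [j /= nj|n0].
  rewrite (bigD1 j) //= nj big1 ?addn0 => [|i neij].
    have : (gpent_pos j = 0 \/ 5 <= gpent_pos j)%N.
      rewrite /gpent_pos; case: (nat_of_ord j) => [|[|m]]; [by left|by right|].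
      by right; rewrite !gpentS; lia.
    by rewrite lt0b (eqP nj); move: (gpent_pos j) => p [->|]; nia.
  apply/eqP; rewrite eqb0 (eqP nj) eqn_pmul2l ?(ltn_trans _ l_ge3) //.
  by apply: contraNneq neij => /gpent_pos_inj /val_inj ->.
by rewrite big1 // => j _; rewrite n0.
Qed.

Lemma truncated_pent_nneg_one l n : l = 3%N \/ (6 <= l)%N ->
  0 <= fpscoef
    ((-1) ^+ 1 *
       (qpoch ('q ^+ l) ('q ^+ l)
        - qpoch ('q ^+ l) ('q ^+ l) / qpoch 'q 'q * pent_sum 'q 1)
     : fps int) n.
Proof.
move=> hl; have l_ge3 : (3 <= l)%N by case: hl => [->|]; lia.
have l_gt0 : (0 < l)%N by exact: leq_trans l_ge3.
have [g [g0 g1] quot] := regular_quotient n.+1 hl.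
have := @qpoch_pent_sum int l n.+1 n.+1 l_gt0 (leqnn _) n (leqnn _).
move: quot; set L := qpoch ('q ^+ l) _; set Q := qpoch 'q 'q => quot Ln.
have -> : pent_sum 'q 1 = 1 - 'q :> fps int.
  by rewrite /pent_sum big_ord1 expr0 !mul1r expr1.
have -> : (-1) ^+ 1 * (L - L / Q * (1 - 'q)) = L / Q * (1 - 'q) - L.
  by rewrite expr1 mulN1r opprB.
rewrite fpscoefD fpscoefN subr_ge0 Ln.
apply: le_trans (fpscoef_pent_sum_le _ _ _) _.
have eq1 : fps_eqmod n.+1 (1 - 'q : fps int) (1 - 'q) by [].
rewrite (fps_eqmodM quot eq1) //.
have -> : g / denom125 * (1 - 'q) = g * ((1 - 'q ^+ 2)^-1 * (1 - 'q ^+ 5)^-1).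
  by rewrite mulrAC [g * (1 - _)]mulrC divr_first_factor ?unit_1subX // mulrA.
have h0 := fps_nnegM (@fps_nneg_geom 2 isT) (@fps_nneg_geom 5 isT).
apply: le_trans (fpscoefM_ge g0 h0 (leq0n n)); rewrite g1 mul1r subn0.
apply: (@le_trans _ _ ((n != 1) && (n != 3))%N%:R).
  by rewrite ler_nat gpent_pos_sparse.
have [n13|] := boolP (_ && _); last by rewrite h0.
have [i lein /andP[di dni]] : exists2 i, (i <= n)%N & (2 %| i)%N && (5 %| n - i)%N.
  (* n is 0 + n for n even and 5 + an even number for n odd and at least 5. *)
  have [odd_n|even_n] := boolP (odd n).
    by exists (n - 5)%N; lia.
  by exists n; lia.
apply: le_trans (fpscoefM_ge (@fps_nneg_geom 2 isT) (@fps_nneg_geom 5 isT) lein).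
by rewrite !fpscoef_geom // di dni.
Qed.

(** * The theorem *)

(** The indices -j and j + 1 of the two-sided sum form the term j of
    [pent_sum]. *)
Lemma pent_sum_zrange k :
  \sum_(j <- zrange (- k%:Z + 1) k%:Z) (-1) ^ j * 'q ^ pent j =
  pent_sum 'q k :> fps int.
Proof.
elim: k => [|k IHk]; first by rewrite /pent_sum big_ord0 big_nil.
have perm : perm_eq (zrange (- k.+1%:Z + 1) k.+1%:Z)
    [:: - k%:Z, k.+1%:Z & zrange (- k%:Z + 1) k%:Z].
  apply: uniq_perm; first exact: zrange_uniq.
    rewrite /= zrange_uniq inE !mem_zrange; lia.
  by move=> j; rewrite !inE !mem_zrange; lia.
have pentN : pent (- k%:Z) = gpent k.
  by have := pent2 (- k%:Z); have := double_gpent k; nia.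
have pentS : pent k.+1%:Z = (gpent k + (2 * k + 1))%N.
  by have := pent2 k.+1%:Z; have := double_gpent k; nia.
rewrite (perm_big _ perm) !big_cons IHk pentN pentS /pent_sum big_ord_recr /=.
rewrite -[X in X + _](_ : (-1) ^+ k * 'q ^+ gpent k = _); last first.
  by rewrite -invr_expz -exprnP -signr_odd; case: (odd k); rewrite ?invr1 ?invrN1.
rewrite -!exprnP exprS exprD; ring.
Qed.

Theorem theorem5p2 (k l : nat) (hk : (1 <= k)%N)
    (hl : l = 3%N \/ (6 <= l)%N) (n : nat) :
  0 <= fpscoef
    ((-1) ^+ k *
       (qpoch ('q ^+ l) ('q ^+ l)
        - qpoch ('q ^+ l) ('q ^+ l) / qpoch 'q 'q
          * \sum_(j <- zrange (- k%:Z + 1) k%:Z) (-1) ^ j * 'q ^ pent j)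
     : fps int) n.
Proof.
rewrite pent_sum_zrange; case: k hk => [|[|k]] // _.
  exact: truncated_pent_nneg_one.
exact: truncated_pent_nneg_ge2.
Qed.
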